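(* An almost-graphic family of binary linear codes cannot be asymptotically good.
   Context: All codes are binary linear codes. For a code $\mathcal{C}$ of length $n$ and a permutation $\pi$ of $[n]=\{1,\dots,n\}$, $\pi(\mathcal{C})$ is the code obtained by permuting coordinates by $\pi$; two codes are equivalent if one is obtained from the other by a coordinate permutation. For $J\subseteq[n]$, $\mathcal{C}|_J$ denotes the restriction (projection) of $\mathcal{C}$ onto the coordinates in $J$. Puncturing $\mathcal{C}$ at $J$ means deleting the coordinates in $J$ from every codeword; shortening $\mathcal{C}$ at $J$ means taking the codewords that are zero on $J$ and then deleting the coordinates in $J$. A minor of $\mathcal{C}$ is any code obtained from $\mathcal{C}$ by a (possibly empty) sequence of puncturings and shortenings. A family of codes is minor-closed if, for every code in it, every code equivalent to a minor of that code is also in the family. A graphic code is a code having as a parity-check matrix the vertex-edge incidence matrix of some finite undirected graph (columns indexed by edges); $\Gamma$ denotes the set of graphic codes. A code $\mathcal{C}$ of length $n$ is 2-connected if there is no partition $(J,J^c)$ of $[n]$ with $J,J^c$ both nonempty and $\dim(\mathcal{C}|_J)+\dim(\mathcal{C}|_{J^c})=\dim(\mathcal{C})$. 2-sum: let $\mathcal{C},\mathcal{C}'$ have lengths $n,n'\ge 3$, such that $0\cdots01$ is a codeword of neither $\mathcal{C}$ nor $\mathcal{C}^\perp$, and $10\cdots0$ is a codeword of neither $\mathcal{C}'$ nor $\mathcal{C}'^\perp$. Then $\mathcal{C}\oplus_2\mathcal{C}'=\{(c_1,\dots,c_{n-1},c'_2,\dots,c'_{n'}) : c\in\mathcal{C},\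 c'\in\mathcal{C}',\ c_n=c'_1\}$. 3-sum: let $\mathcal{C},\mathcal{C}'$ have lengths $n,n'\ge 7$ such that (A1) no codeword of $\mathcal{C}$ or $\mathcal{C}^\perp$ has the form $0\cdots0\,x$ with $x$ a length-3 word of Hamming weight 1 or 2; (A2) no codeword of $\mathcal{C}'$ or $\mathcal{C}'^\perp$ has the form $x\,0\cdots0$ with $x$ a length-3 word of weight 1 or 2; (A3) $0\cdots0111\in\mathcal{C}$ and $1110\cdots0\in\mathcal{C}'$. Then $\mathcal{C}\oplus_3\mathcal{C}'=\{(c_1,\dots,c_{n-3},c'_4,\dots,c'_{n'}): c\in\mathcal{C}, c'\in\mathcal{C}', (c_{n-2},c_{n-1},c_n)=(c'_1,c'_2,c'_3)\}$. $\bar 3$-sum: let $\mathcal{C},\mathcal{C}'$ have lengths $\ge 7$ satisfying (A1), (A2) and (A3$'$) $0\cdots0111\in\mathcal{C}^\perp$ and $1110\cdots0\in\mathcal{C}'^\perp$. Then $\mathcal{C}\,\overline{\oplus}_3\,\mathcal{C}'=\overline{\mathcal{C}}\oplus_3\overline{\mathcal{C}'}$, where $\overline{\mathcal{C}}=\mathcal{C}\cup(0\cdots0111+\mathcal{C})$ and $\overline{\mathcal{C}'}=\mathcal{C}'\cup(1110\cdots0+\mathcal{C}')$. A minor-closed family $\mathfrak{C}$ is almost-graphic if there is a finite sub-family $\mathfrak{D}\subseteq\mathfrak{C}$ such that every 2-connected code $\mathcal{C}\in\mathfrak{C}$ either lies in $\Gamma\cup\mathfrak{D}$ or equals $\pi(\mathcal{C}_1\oplus_2\mathcal{C}_2)$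 or $\pi(\mathcal{C}_1\,\overline{\oplus}_3\,\mathcal{C}_2)$ for some coordinate permutation $\pi$ and codes $\mathcal{C}_1,\mathcal{C}_2$ that are equivalent to minors of $\mathcal{C}$, with $\mathcal{C}_1\in\Gamma\cup\mathfrak{D}$ and $\mathcal{C}_2$ 2-connected. A family of codes is asymptotically good if it contains a sequence of $[n_i,k_i,d_i]$ codes (length, dimension, minimum distance) with $n_i\to\infty$, $\liminf_i k_i/n_i>0$ and $\liminf_i d_i/n_i>0$. *)

(* Defs.v *)
From HB Require Import structures.
From mathcomp Require Import all_boot all_order all_fingroup all_algebra.
From mathcomp Require Import all_classical all_reals all_analysis.
Set Implicit Arguments.
Unset Strict Implicit.
Unset Printing Implicit Defensive.
Import GRing.Theory.
Local Open Scope ring_scope.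

Definition bcode (n : nat) : Type := {vspace 'rV['F_2]_n}.

(* Codes of all lengths; equality in this type includes equality of lengths. *)
Definition any_code : Type := {n : nat & bcode n}.

Definition Code (n : nat) (C : bcode n) : any_code := existT bcode n C.

Definition code_family : Type := any_code -> Prop.

Definition hdist (n : nat) (x y : 'rV['F_2]_n) : nat :=
  #|[set i : 'I_n | x 0 i != y 0 i]|%SET.

Definition hweight (n : nat) (x : 'rV['F_2]_n) : nat := hdist x 0.

(* The length n, an upper bound of all distances, is only the conventional value
   for the zero code. *)
Definition min_dist (n : nat) (C : bcode n) : nat :=
  \big[minn/n]_(p : 'rV['F_2]_n * 'rV['F_2]_n
               | [&& p.1 \in C, p.2 \in C & p.1 != p.2]) hdist p.1 p.2.

(* The span is used only to make a vspace out of a set S that is already closed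
   under addition (see mem_code_of). *)
Definition code_of (n : nat) (S : {set 'rV['F_2]_n}) : bcode n :=
  <<enum S>>%VS.

Definition dual (n : nat) (C : bcode n) : bcode n :=
  code_of [set y : 'rV['F_2]_n | [forall (c | c \in C), c *m y^T == 0]]%SET.

Definition perm_code (n : nat) (s : 'S_n) (C : bcode n) : bcode n :=
  (linfun (fun c : 'rV['F_2]_n => col_perm s c) @: C)%VS.

Definition equivalent (A B : any_code) : Prop :=
  exists s : 'S_(tag A), B = Code (perm_code s (tagged A)).

(* Projection onto the coordinates in J, listed in increasing order. *)
Definition coord_proj (n : nat) (J : {set 'I_n}) : 'Hom('rV['F_2]_n, 'rV['F_2]_#|J|) :=
  linfun (fun c : 'rV['F_2]_n => \row_(i < #|J|) c 0 (enum_val i)).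

Definition code_restrict (n : nat) (J : {set 'I_n}) (C : bcode n) : bcode #|J| :=
  (coord_proj J @: C)%VS.

Definition puncture (n : nat) (J : {set 'I_n}) (C : bcode n) : bcode #|~: J|%SET :=
  code_restrict (~: J)%SET C.

Definition shorten (n : nat) (J : {set 'I_n}) (C : bcode n) : bcode #|~: J|%SET :=
  code_restrict (~: J)%SET (C :&: lker (coord_proj J))%VS.

Inductive has_minor (A : any_code) : any_code -> Prop :=
| has_minor_refl : has_minor A A
| has_minor_puncture (n : nat) (C : bcode n) (J : {set 'I_n}) :
    has_minor A (Code C) -> has_minor A (Code (puncture J C))
| has_minor_shorten (n : nat) (C : bcode n) (J : {set 'I_n}) :
    has_minor A (Code C) -> has_minor A (Code (shorten J C)).

Definition equiv_to_minor (A B : any_code) : Prop :=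
  exists2 M, has_minor A M & equivalent M B.

Definition minor_closed (F : code_family) : Prop :=
  forall A B, F A -> equiv_to_minor A B -> F B.

Definition parity_check (k n : nat) (H : 'M['F_2]_(k, n)) (C : bcode n) : Prop :=
  forall c : 'rV['F_2]_n, (c \in C) <-> H *m c^T = 0.

(* A graph with vertices 'I_k and edges 'I_n is given by the endpoints of its
   edges (in an irrelevant order); loops and parallel edges are allowed.  A loop
   is incident twice with its vertex, so that its column vanishes mod 2. *)
Definition incidence (k n : nat) (ends : 'I_n -> 'I_k * 'I_k) : 'M['F_2]_(k, n) :=
  \matrix_(v < k, e < n) ((v == (ends e).1)%:R + (v == (ends e).2)%:R).

Definition graphic (A : any_code) : Prop :=
  exists (k : nat) (ends : 'I_(tag A) -> 'I_k * 'I_k),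
    parity_check (incidence ends) (tagged A).

Definition two_connected (A : any_code) : Prop :=
  ~ exists J : {set 'I_(tag A)},
    [/\ J != finset.set0, (~: J)%SET != finset.set0
      & (\dim (code_restrict J (tagged A)) + \dim (code_restrict (~: J)%SET (tagged A)))%N
        = \dim (tagged A)].

(* Common part of the 2-sum (k = 1) and the 3-sum (k = 3): identify the last k
   coordinates of C with the first k coordinates of C', then delete them. *)
Definition code_glue (m k m' : nat) (C : bcode (m + k)) (C' : bcode (k + m')) :
    bcode (m + m') :=
  code_of [set row_mx (lsubmx p.1) (rsubmx p.2)
          | p : 'rV['F_2]_(m + k) * 'rV['F_2]_(k + m')
          & [&& p.1 \in C, p.2 \in C' & rsubmx p.1 == lsubmx p.2]]%SET.

Definition last_word (m k : nat) (x : 'rV['F_2]_k) : 'rV['F_2]_(m + k) :=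
  row_mx 0 x.

Definition first_word (k m : nat) (x : 'rV['F_2]_k) : 'rV['F_2]_(k + m) :=
  row_mx x 0.

Definition two_sum_cond (m m' : nat) (C : bcode (m + 1)) (C' : bcode (1 + m')) :
    Prop :=
  [/\ (3 <= m + 1)%N, (3 <= 1 + m')%N,
      last_word m (const_mx 1) \notin C /\ last_word m (const_mx 1) \notin dual C
    & first_word m' (const_mx 1) \notin C' /\
      first_word m' (const_mx 1) \notin dual C'].

Definition two_sum (m m' : nat) (C : bcode (m + 1)) (C' : bcode (1 + m')) :
    bcode (m + m') :=
  code_glue C C'.

Definition three_sum_A1 (m : nat) (C : bcode (m + 3)) : Prop :=
  forall x : 'rV['F_2]_3, hweight x = 1%N \/ hweight x = 2%N ->
    last_word m x \notin C /\ last_word m x \notin dual C.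

Definition three_sum_A2 (m' : nat) (C' : bcode (3 + m')) : Prop :=
  forall x : 'rV['F_2]_3, hweight x = 1%N \/ hweight x = 2%N ->
    first_word m' x \notin C' /\ first_word m' x \notin dual C'.

Definition three_sum (m m' : nat) (C : bcode (m + 3)) (C' : bcode (3 + m')) :
    bcode (m + m') :=
  code_glue C C'.

Definition bar3_sum_cond (m m' : nat) (C : bcode (m + 3)) (C' : bcode (3 + m')) :
    Prop :=
  [/\ (7 <= m + 3)%N /\ (7 <= 3 + m')%N, three_sum_A1 C, three_sum_A2 C'
    & last_word m (const_mx 1) \in dual C /\
      first_word m' (const_mx 1) \in dual C'].

(* Over F_2, C + <[v]> is the union of C and v + C (see mem_add_word). *)
Definition add_word (n : nat) (v : 'rV['F_2]_n) (C : bcode n) : bcode n :=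
  (C + <[v]>)%VS.

Definition bar3_sum (m m' : nat) (C : bcode (m + 3)) (C' : bcode (3 + m')) :
    bcode (m + m') :=
  three_sum (add_word (last_word m (const_mx 1)) C)
            (add_word (first_word m' (const_mx 1)) C').

Definition is_two_sum (A A1 A2 : any_code) : Prop :=
  exists (m m' : nat) (C1 : bcode (m + 1)) (C2 : bcode (1 + m')) (s : 'S_(m + m')),
    [/\ A1 = Code C1, A2 = Code C2, two_sum_cond C1 C2
      & A = Code (perm_code s (two_sum C1 C2))].

Definition is_bar3_sum (A A1 A2 : any_code) : Prop :=
  exists (m m' : nat) (C1 : bcode (m + 3)) (C2 : bcode (3 + m')) (s : 'S_(m + m')),
    [/\ A1 = Code C1, A2 = Code C2, bar3_sum_cond C1 C2
      & A = Code (perm_code s (bar3_sum C1 C2))].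

Definition almost_graphic (F : code_family) : Prop :=
  minor_closed F /\
  exists D : seq any_code,
    (forall A : any_code, A \in D -> F A) /\
    forall A, F A -> two_connected A ->
      (graphic A \/ A \in D) \/
      exists A1 A2 : any_code,
        [/\ is_two_sum A A1 A2 \/ is_bar3_sum A A1 A2,
            equiv_to_minor A A1, equiv_to_minor A A2,
            graphic A1 \/ A1 \in D
          & two_connected A2].

Definition asymptotically_good (R : realType) (F : code_family) : Prop :=
  exists c : nat -> any_code,
    let n i := tag (c i) in
    let k i := \dim (tagged (c i)) in
    let d i := min_dist (tagged (c i)) in
    [/\ forall i, F (c i),
        (n i @[i --> \oo] --> \oo)%classic,
        (0 < limn_einf (fun i => ((k i)%:R / (n i)%:R : R)%:E))%E
      & (0 < limn_einf (fun i => ((d i)%:R / (n i)%:R : R)%:E))%E].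

Lemma F2_cases (a : 'F_2) : a = 0 \/ a = 1.
Proof. by case: a => [[|[|a]] Ha] //; [left | right]; apply: val_inj. Qed.

Lemma mem_code_of (n : nat) (S : {set 'rV['F_2]_n}) :
  0 \in S -> (forall x y, x \in S -> y \in S -> x + y \in S) ->
  forall x, (x \in code_of S) = (x \in S).
Proof.
move=> S0 SD x; apply/idP/idP => [Hx|Hx]; last first.
  by apply: memv_span; rewrite mem_enum.
have := coord_span (X := in_tuple (enum S)) Hx => ->.
apply: (big_ind (fun z => z \in S)) => // i _.
case: (F2_cases (coord (in_tuple (enum S)) i x)) => ->; first by rewrite scale0r.
by rewrite scale1r -mem_enum mem_nth.
Qed.

Lemma mem_dual (n : nat) (C : bcode n) (y : 'rV['F_2]_n) :
  y \in dual C <-> forall c, c \in C -> c *m y^T = 0.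
Proof.
rewrite mem_code_of; first last.
- move=> u v; rewrite !inE => /'forall_implyP Hu /'forall_implyP Hv.
  apply/'forall_implyP => c Hc.
  by rewrite linearD mulmxDr (eqP (Hu c Hc)) (eqP (Hv c Hc)) addr0.
- by rewrite inE; apply/'forall_implyP => c Hc; rewrite trmx0 mulmx0.
rewrite inE; split=> [/'forall_implyP H c /H /eqP //|H].
by apply/'forall_implyP => c /H ->.
Qed.

Lemma mem_code_glue (m k m' : nat) (C : bcode (m + k)) (C' : bcode (k + m'))
    (x : 'rV['F_2]_(m + m')) :
  x \in code_glue C C' <->
  exists (c : 'rV['F_2]_(m + k)) (c' : 'rV['F_2]_(k + m')),
    [/\ c \in C, c' \in C', rsubmx c = lsubmx c'
      & x = row_mx (lsubmx c) (rsubmx c')].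
Proof.
rewrite mem_code_of; first last.
- move=> u v /imsetP[[a a'] /=]; rewrite !inE /= => /and3P[Ha Ha' /eqP E] ->.
  move=> /imsetP[[b b'] /=]; rewrite !inE /= => /and3P[Hb Hb' /eqP E'] ->.
  apply/imsetP; exists (a + b, a' + b').
    by rewrite inE /= !memvD //= !linearD /= E E'.
  by rewrite /= !linearD /= add_row_mx.
- apply/imsetP; exists (0, 0); first by rewrite inE /= !mem0v /= !linear0.
  by rewrite /= !linear0 row_mx0.
split.
  move=> /imsetP[[a a'] /=]; rewrite !inE /= => /and3P[Ha Ha' /eqP E] ->.
  by exists a, a'.
move=> [c [c' [Hc Hc' E ->]]]; apply/imsetP; exists (c, c') => //.
by rewrite inE /= Hc Hc' E eqxx.
Qed.

Lemma mem_add_word (n : nat) (v : 'rV['F_2]_n) (C : bcode n) (x : 'rV['F_2]_n) :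
  x \in add_word v C <-> x \in C \/ exists2 c, c \in C & x = v + c.
Proof.
split.
  move=> /memv_addP[c Hc [w /vlineP[a ->] ->]].
  case: (F2_cases a) => ->; first by left; rewrite scale0r addr0.
  by right; exists c => //; rewrite scale1r addrC.
case=> [Hx|[c Hc ->]]; first by rewrite -(addr0 x) memv_add ?mem0v.
by rewrite addrC memv_add ?memv_line.
Qed.

Lemma mem_perm_code (n : nat) (s : 'S_n) (C : bcode n) (x : 'rV['F_2]_n) :
  x \in perm_code s C <-> exists2 c, c \in C & forall i, x 0 i = c 0 (s i).
Proof.
split=> [/memv_imgP[c Hc ->]|[c Hc H]].
  by exists c => // i; rewrite lfunE /= mxE.
apply/memv_imgP; exists c => //; rewrite lfunE /=.
by apply/rowP => i; rewrite H mxE.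
Qed.

Lemma coord_projE (n : nat) (J : {set 'I_n}) (c : 'rV['F_2]_n) :
  coord_proj J c = \row_(i < #|J|) c 0 (enum_val i).
Proof.
pose f : 'rV['F_2]_n -> 'rV['F_2]_#|J| := mxsub id (@enum_val _ (mem J)).
have -> : coord_proj J = linfun f.
  by congr linfun; apply/funext => u; apply/rowP => i; rewrite !mxE.
by rewrite lfunE /=; apply/rowP => i; rewrite !mxE.
Qed.

Lemma mem_code_restrict (n : nat) (J : {set 'I_n}) (C : bcode n)
    (x : 'rV['F_2]_#|J|) :
  x \in code_restrict J C <->
  exists2 c, c \in C & forall i : 'I_#|J|, x 0 i = c 0 (enum_val i).
Proof.
split=> [/memv_imgP[c Hc ->]|[c Hc H]].
  by exists c => // i; rewrite coord_projE mxE.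
apply/memv_imgP; exists c => //; rewrite coord_projE.
by apply/rowP => i; rewrite H mxE.
Qed.

Lemma mem_shorten (n : nat) (J : {set 'I_n}) (C : bcode n)
    (x : 'rV['F_2]_#|~: J|%SET) :
  x \in shorten J C <->
  exists c, [/\ c \in C, forall j, j \in J -> c 0 j = 0
              & forall i, x 0 i = c 0 (enum_val i)].
Proof.
have kerP c : (c \in lker (coord_proj J)) <-> forall j, j \in J -> c 0 j = 0.
  rewrite memv_ker coord_projE; split=> [/eqP/rowP H j jJ|H].
    by have := H (enum_rank_in jJ j); rewrite !mxE enum_rankK_in.
  by apply/eqP/rowP => i; rewrite !mxE H // enum_valP.
rewrite mem_code_restrict; split=> [[c]|[c [Hc /kerP Hk H]]].
  by rewrite memv_cap => /andP[Hc /kerP Hk] H; exists c.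
by exists c => //; rewrite memv_cap Hc.
Qed.

(* Main.v *)
Require Import Defs.
From mathcomp Require Import all_boot all_order all_fingroup all_algebra.
From mathcomp Require Import all_classical all_reals all_analysis.
From mathcomp Require Import zify.

(** Give the coordinates nonnegative weights of total W such that every nonzero
    codeword has weight at least d; then the dimension is bounded in terms of W/d
    alone, so that a linear minimum distance forces a bounded dimension.

    For cycle codes of graphs: grow a ball around a vertex of a cycle.  Balls of
    radius at most d/4 contain no cycle, and by averaging some radius between d/8
    and d/4 is crossed by at most 8W/d edges.  Deleting all edges that meet the ball
    costs at most that much dimension and uses up weight d/8, so the process stops
    after O(W/d) rounds.

    For a sum of C1 and C2 along glued coordinates: put on the glued coordinates of
    C2 weights that record the lightest words of C1 with given glued part.  For the
    3-bar-sum, where the glued parts are 000, 011, 101, 110, the three minima satisfy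
    the triangle inequality, hence come from weights on three coordinates (a
    triangle-star exchange).  The total weight does not increase; the dimension drops
    by that of the words of C1 vanishing on the glued coordinates, which is bounded
    by the graphic case, and if there is such a nonzero word, then averaging over
    its translates shows that the total weight drops by at least d/4. *)

Set Implicit Arguments.
Unset Strict Implicit.
Unset Printing Implicit Defensive.
Import Order.TTheory GRing.Theory Num.Theory.
Local Open Scope ring_scope.

(** * Weights and supports *)

Definition wt (n : nat) (w : 'I_n -> nat) (x : 'rV['F_2]_n) : nat :=
  (\sum_i (x 0%R i != 0%R) * w i)%N.

Definition supp (n : nat) (x : 'rV['F_2]_n) : {set 'I_n} :=
  [set i | x 0 i != 0]%SET.

Lemma F2_addb (a b : 'F_2) : (a + b != 0) = (a != 0) (+) (b != 0).
Proof. by case: (F2_cases a) => ->; case: (F2_cases b) => ->. Qed.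

Lemma F2_addrr (V : lmodType 'F_2) (x : V) : x + x = 0.
Proof. by rewrite -mulr2n -scaler_nat pchar_Zp // scale0r. Qed.

Lemma F2_oppr (V : lmodType 'F_2) (x : V) : - x = x.
Proof. by apply/eqP; rewrite eq_sym -addr_eq0 F2_addrr. Qed.

Lemma bigminn_le (I : finType) (P : pred I) (f : I -> nat) (d : nat) (i : I) :
  P i -> (\big[minn/d]_(j | P j) f j <= f i)%N.
Proof.
move=> Pi; have : i \in index_enum I by rewrite mem_index_enum.
elim: (index_enum I) => // a s IH; rewrite inE big_cons => /orP[/eqP <-|/IH le_i].
  by rewrite Pi geq_minl.
by case: ifP => // _; exact: leq_trans (geq_minr _ _) le_i.
Qed.

Lemma bigminn_attained (I : finType) (P : pred I) (f : I -> nat) (d : nat) :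
  (\big[minn/d]_(j | P j) f j < d)%N ->
  exists2 i, P i & f i = \big[minn/d]_(j | P j) f j.
Proof.
pose R x := x = d \/ exists2 i, P i & f i = x.
have : R (\big[minn/d]_(j | P j) f j).
  apply: big_ind => [|x y Rx Ry|i Pi]; [by left | | by right; exists i].
  by rewrite /R /minn; case: ifP.
by case=> [->|//]; rewrite ltnn.
Qed.

Lemma wt_add (n : nat) (w : 'I_n -> nat) (x y : 'rV['F_2]_n) :
  (wt w (x + y) <= wt w x + wt w y)%N.
Proof.
rewrite -big_split; apply: leq_sum => i _ /=; rewrite -mulnDl leq_mul2r mxE F2_addb.
by apply/orP; right; do 2 case: (_ != _).
Qed.

Lemma wt_delta (n : nat) (w : 'I_n -> nat) (e : 'I_n) :
  wt w (delta_mx 0 e) = w e.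
Proof.
rewrite /wt (bigD1 e) //= mxE !eqxx mul1n big1 ?addn0 // => i /negPf ie.
by rewrite mxE ie andbF eqxx.
Qed.

Lemma wt0 (n : nat) (w : 'I_n -> nat) : wt w 0 = 0%N.
Proof. by apply: big1 => i _; rewrite mxE eqxx. Qed.

Lemma wt_scale (n : nat) (w : 'I_n -> nat) (a : nat) (x : 'rV['F_2]_n) :
  wt (fun i => a * w i)%N x = (a * wt w x)%N.
Proof. by rewrite big_distrr; apply: eq_bigr => i _; rewrite /= mulnCA. Qed.

Lemma supp_add (n : nat) (x y : 'rV['F_2]_n) (E : {set 'I_n}) :
  supp x \subset E -> supp y \subset E -> supp (x + y) \subset E.
Proof.
move=> /fintype.subsetP sx /fintype.subsetP sy; apply/fintype.subsetP => i.
rewrite inE mxE F2_addb => H.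
by move: (sx i) (sy i); rewrite !inE; move: H; do 2 case: (_ != 0) => //=; auto.
Qed.

Lemma supp_delta (n : nat) (e : 'I_n) (E : {set 'I_n}) :
  e \in E -> supp (delta_mx 0 e) \subset E.
Proof.
by move=> eE; apply/fintype.subsetP => i; rewrite inE mxE eqxx /=; case: (i =P e) => [->|].
Qed.

Lemma suppP (n : nat) (x : 'rV['F_2]_n) (E : {set 'I_n}) :
  reflect (forall i, x 0 i != 0 -> i \in E) (supp x \subset E).
Proof.
apply: (iffP fintype.subsetP) => H i; first by move=> xi; apply: H; rewrite inE.
by rewrite inE => /H.
Qed.

Lemma mem_ker_coord_proj (n : nat) (S : {set 'I_n}) (c : 'rV['F_2]_n) :
  reflect (forall j, j \in S -> c 0 j = 0) (c \in lker (coord_proj S)).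
Proof.
rewrite memv_ker coord_projE; apply: (iffP eqP) => [/rowP H j jS|H].
  by have := H (enum_rank_in jS j); rewrite !mxE enum_rankK_in.
by apply/rowP => i; rewrite !mxE H // enum_valP.
Qed.

(** Rank-nullity for the projection onto [S]. It prices the deletion of edges below: each coordinate
    forced to zero costs at most one dimension. *)
Lemma dim_le_vanishing (n : nat) (S : {set 'I_n}) (U : {vspace 'rV['F_2]_n}) :
  (\dim U <= #|S| + \dim (U :&: lker (coord_proj S)))%N.
Proof.
rewrite -(limg_ker_dim (coord_proj S) U) addnC leq_add2r.
by apply: leq_trans (dimvS (subvf _)) _; rewrite dimvf /dim /= mul1n.
Qed.

(** * Cycle codes of graphs *)

Definition boundary (n k : nat) (ends : 'I_n -> 'I_k * 'I_k) (c : 'rV['F_2]_n) :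
    'rV['F_2]_k :=
  c *m (incidence ends)^T.

Lemma boundary_add (n k : nat) (ends : 'I_n -> 'I_k * 'I_k) (x y : 'rV['F_2]_n) :
  boundary ends (x + y) = boundary ends x + boundary ends y.
Proof. exact: mulmxDl. Qed.

Lemma boundary_delta (n k : nat) (ends : 'I_n -> 'I_k * 'I_k) (e : 'I_n) :
  boundary ends (delta_mx 0 e) = delta_mx 0 (ends e).1 + delta_mx 0 (ends e).2.
Proof. by rewrite /boundary -rowE; apply/rowP => v; rewrite !mxE !eqxx. Qed.

(* Distance from v, truncated at d: the least weight of a chain in E with
   boundary {u, v}. *)
Definition chain_dist (n k : nat) (ends : 'I_n -> 'I_k * 'I_k) (w : 'I_n -> nat)
    (E : {set 'I_n}) (d : nat) (v u : 'I_k) : nat :=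
  \big[minn/d]_(P : 'rV['F_2]_n | (boundary ends P == delta_mx 0 u + delta_mx 0 v)
      && (supp P \subset E)) wt w P.

Lemma chain_dist0 (n k : nat) (ends : 'I_n -> 'I_k * 'I_k) (w : 'I_n -> nat)
    (E : {set 'I_n}) (d : nat) (v : 'I_k) : chain_dist ends w E d v v = 0%N.
Proof.
apply/eqP; rewrite -leqn0 -(wt0 w); apply: bigminn_le.
rewrite /boundary mul0mx F2_addrr eqxx /=.
by apply/suppP => i; rewrite mxE eqxx.
Qed.

Lemma chain_dist_le (n k : nat) (ends : 'I_n -> 'I_k * 'I_k) (w : 'I_n -> nat)
    (E : {set 'I_n}) (d : nat) (v u : 'I_k) : (chain_dist ends w E d v u <= d)%N.
Proof.
by rewrite /chain_dist; elim/big_rec: _ => // P x _; apply: leq_trans (geq_minr _ _).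
Qed.

Lemma chain_dist_edge (n k : nat) (ends : 'I_n -> 'I_k * 'I_k) (w : 'I_n -> nat)
    (E : {set 'I_n}) (d : nat) (v : 'I_k) (e : 'I_n) (u u' : 'I_k) : e \in E ->
  (u, u') = ends e \/ (u', u) = ends e ->
  (chain_dist ends w E d v u' <= chain_dist ends w E d v u + w e)%N.
Proof.
move=> eE uu'.
(* If the distance of [u] is the truncation value [d], nothing is left to show; otherwise a lightest
   chain exists, and [e] is added to it. *)
have [lt_d|ge_d] := ltnP (chain_dist ends w E d v u) d; last first.
  by apply: leq_trans (chain_dist_le _ _ _ _ _ _) (leq_trans ge_d (leq_addr _ _)).
have [P /andP[/eqP bP sP] wP] := bigminn_attained lt_d.
rewrite /chain_dist -wP -(wt_delta w e).
apply: leq_trans (wt_add _ _ _); apply: bigminn_le.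
rewrite supp_add ?supp_delta // andbT boundary_add bP boundary_delta; apply/eqP.
have E2 (x y z : 'rV['F_2]_k) : x + y + (x + z) = z + y.
  by rewrite addrACA F2_addrr add0r addrC.
by case: uu' => <- /=; rewrite ?E2 // [delta_mx 0 u' + delta_mx 0 u]addrC E2.
Qed.

Definition dist_ball (n k : nat) (ends : 'I_n -> 'I_k * 'I_k) (w : 'I_n -> nat)
    (E : {set 'I_n}) (d : nat) (v : 'I_k) (s : nat) : pred 'I_k :=
  fun u => (chain_dist ends w E d v u < s)%N.

(** Join each vertex [u] of the ball to the centre by a chain [P u] of weight below [s]. For an edge
    of [c], the edge and the chains of its two ends form a cycle of weight below [2 * s + r], which
    must be zero. Hence each edge of [c] is the sum of two chains, and these sums cancel because [c]
    has no boundary. *)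
Lemma cycle_in_ball_eq0 (n k : nat) (ends : 'I_n -> 'I_k * 'I_k) (w : 'I_n -> nat)
    (E : {set 'I_n}) (d r s : nat) (v : 'I_k) (c : 'rV['F_2]_n) :
  (forall x, boundary ends x = 0 -> supp x \subset E -> x != 0 ->
    (d <= wt w x)%N) ->
  (forall e, e \in E -> (w e < r)%N) -> (2 * s + r <= d)%N ->
  boundary ends c = 0 -> supp c \subset E ->
  (forall e, c 0 e != 0 -> dist_ball ends w E d v s (ends e).1 /\
                          dist_ball ends w E d v s (ends e).2) ->
  c = 0.
Proof.
move=> girth light sd bc /suppP sc inb.
have /boolp.choice[P Pball] (u : 'I_k) : exists p, dist_ball ends w E d v s u ->
   [/\ boundary ends p = delta_mx 0 u + delta_mx 0 v, supp p \subset E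
     & (wt w p < s)%N].
  have [bu|nbu] := boolP (dist_ball ends w E d v s u); last by exists 0.
  have ltd : (chain_dist ends w E d v u < d)%N.
    by apply: leq_trans bu _; move: sd; lia.
  have [p /andP[/eqP bp sp] wp] := bigminn_attained ltd.
  by exists p; split=> //; rewrite wp.
(* As a linear map, [M] replaces a vertex by its chain; [edge] says that the boundary followed by
   [M] fixes every edge of [c]. *)
pose M := \matrix_u P u.
have edge e : c 0 e != 0 -> boundary ends (delta_mx 0 e) *m M = delta_mx 0 e.
  move=> ce; have [b1 b2] := inb e ce.
  have [bP1 sP1 wP1] := Pball _ b1; have [bP2 sP2 wP2] := Pball _ b2.
  rewrite boundary_delta mulmxDl -!rowE !rowK.
  apply/eqP; rewrite -subr_eq0; apply: contraT => nz.
  have := girth _ _ _ nz; rewrite F2_oppr !boundary_add bP1 bP2 boundary_delta.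
  rewrite [X in X + _]addrACA !F2_addrr addr0 F2_addrr => /(_ erefl).
  rewrite !supp_add ?supp_delta ?sc // => /(_ isT).
  move=> /leq_trans/(_ (wt_add _ _ _)).
  have := light _ (sc e ce); have := wt_add w (P (ends e).1) (P (ends e).2).
  rewrite wt_delta; move: (wt w (_ + _)) sd wP1 wP2 => x; lia.
rewrite -(mul0mx _ M) -bc /boundary {1 2}[c]row_sum_delta !mulmx_suml.
apply: eq_bigr => e _; rewrite -!scalemxAl.
have [->|ce] := eqVneq (c 0 e) 0; first by rewrite !scale0r.
by rewrite -/(boundary ends _) edge.
Qed.

(** The levels that separate [a] from [b] are those from the smaller up to, but excluding, the
    larger. *)
Lemma levels_crossed (a b w m m' : nat) : (a <= b + w)%N -> (b <= a + w)%N ->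
  (\sum_(m <= i < m') ((a <= i) != (b <= i)) <= w)%N.
Proof.
move=> ab ba; have [lem|/ltnW ltm] := leqP m m'; last by rewrite big_geq.
(* Induction on [m'] needs the number of separating levels inside the summation range. *)
suff : (\sum_(m <= i < m') ((a <= i) != (b <= i)) <=
        (maxn (minn m' (maxn a b)) m - maxn m (minn a b)))%N by lia.
elim: m' lem => [|m' IH] lem; first by rewrite big_geq //; lia.
have [lem'|ltm] := leqP m m'; last by rewrite big_geq //; lia.
rewrite big_nat_recr //=; have := IH lem'.
by case: (leqP a m') => ?; case: (leqP b m') => ? /=; lia.
Qed.

(** No edge of [c] leaves [X], so a vertex in [X] keeps all its edges of [c] and a vertex outside
    [X] keeps none. *)
Lemma boundary_restrict (n k : nat) (ends : 'I_n -> 'I_k * 'I_k) (X : pred 'I_k)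
    (c : 'rV['F_2]_n) :
  (forall e, c 0 e != 0 -> X (ends e).1 = X (ends e).2) ->
  boundary ends c = 0 ->
  boundary ends (\row_e if X (ends e).1 then c 0 e else 0) = 0.
Proof.
move=> noX bc; apply/rowP => v; have := congr1 (fun z : 'rV_k => z 0 v) bc.
rewrite !mxE => bv; have [Xv|nXv] := boolP (X v); last first.
  apply: big1 => e _; rewrite !mxE; case: ifP => [X1|]; last by rewrite mul0r.
  have [->|ce] := eqVneq (c 0 e) 0; first by rewrite mul0r.
  have X2 := noX e ce; rewrite X1 in X2.
  case: eqP => [E1|_]; first by rewrite E1 X1 in nXv.
  case: eqP => [E1|_]; first by rewrite E1 -X2 in nXv.
  by rewrite addr0 mulr0.
rewrite -[RHS]bv; apply: eq_bigr => e _; rewrite !mxE; case: ifP => // nX1.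
have [->|ce] := eqVneq (c 0 e) 0; first by rewrite mul0r.
have X2 := noX e ce; rewrite nX1 in X2.
case: eqP => [E1|_]; first by rewrite -E1 Xv in nX1.
case: eqP => [E1|_]; first by rewrite -E1 Xv in X2.
by rewrite addr0 !mulr0.
Qed.

Definition cut (n k : nat) (ends : 'I_n -> 'I_k * 'I_k) (E : {set 'I_n})
    (X : pred 'I_k) : {set 'I_n} :=
  [set e in E | X (ends e).1 != X (ends e).2]%SET.

(** Double counting: the distances of the ends of [e] differ by at most [w e], so [e] lies in at
    most [w e] of the cuts. It is used with [T = E] to find a small cut, and with the edges meeting
    a ball to bound their weight from below. *)
Lemma sum_cut (n k : nat) (ends : 'I_n -> 'I_k * 'I_k) (w : 'I_n -> nat)
    (E T : {set 'I_n}) (d m m' : nat) (v : 'I_k) :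
  T \subset E ->
  (forall i, (i < m')%N -> cut ends E (dist_ball ends w E d v i.+1) \subset T) ->
  (\sum_(m <= i < m') #|cut ends E (dist_ball ends w E d v i.+1)|
   <= \sum_(e in T) w e)%N.
Proof.
move=> /fintype.subsetP TE cT.
rewrite (eq_big_nat _ _ (F2 := fun i => (\sum_(e in T)
    ((chain_dist ends w E d v (ends e).1 <= i) !=
     (chain_dist ends w E d v (ends e).2 <= i)))%N)); last first.
  move=> i /andP[_ im]; rewrite -sum1_card big_mkcond /= [RHS]big_mkcond /=.
  apply: eq_bigr => e _; case: ifP => [ec|].
    by rewrite (fintype.subsetP (cT i im)) //; move: ec; rewrite !inE => /andP[_ ->].
  by case: ifP => // /TE eE; rewrite !inE eE /= /dist_ball !ltnS => ->.
rewrite exchange_big /=; apply: leq_sum => e /TE eE.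
apply: levels_crossed; apply: chain_dist_edge => //; rewrite -surjective_pairing.
  by right.
by left.
Qed.

(** A cycle that avoids the cut splits into a part inside the ball and a part outside; the inner
    part is a cycle in the ball, hence zero. *)
Lemma cycle_uncut_outside (n k : nat) (ends : 'I_n -> 'I_k * 'I_k) (w : 'I_n -> nat)
    (E : {set 'I_n}) (d r s : nat) (v : 'I_k) (c : 'rV['F_2]_n) :
  (forall x, boundary ends x = 0 -> supp x \subset E -> x != 0 ->
    (d <= wt w x)%N) ->
  (forall e, e \in E -> (w e < r)%N) -> (2 * s + r <= d)%N ->
  boundary ends c = 0 -> supp c \subset E ->
  (forall e, e \in cut ends E (dist_ball ends w E d v s) -> c 0 e = 0) ->
  forall e, c 0 e != 0 -> ~~ dist_ball ends w E d v s (ends e).1 /\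
                         ~~ dist_ball ends w E d v s (ends e).2.
Proof.
move=> girth light sd bc /suppP sc ccut.
set X := dist_ball _ _ _ _ _ _.
have noX e : c 0 e != 0 -> X (ends e).1 = X (ends e).2.
  move=> ce; apply: (contraNeq _ ce) => nX; apply/eqP/ccut.
  by rewrite inE sc.
pose cX : 'rV['F_2]_n := \row_e if X (ends e).1 then c 0 e else 0.
have cXE e : cX 0 e != 0 -> X (ends e).1 /\ c 0 e != 0.
  by rewrite mxE; case: ifP => //; rewrite eqxx.
have cX0 : cX = 0.
  apply: (cycle_in_ball_eq0 (v := v) girth light sd) => [||e /cXE[X1 ce]].
  - exact: boundary_restrict.
  - by apply/suppP => e /cXE[_ /sc].
  - by rewrite -/X -(noX e ce).
move=> e ce; rewrite -(noX e ce); suff : ~~ X (ends e).1 by split.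
apply/negP => X1; have := congr1 (fun z : 'rV_n => z 0 e) cX0.
by rewrite !mxE X1 => /eqP; rewrite (negPf ce).
Qed.

(** Each round finds a ball cut by at most [Q] edges and forces these coordinates to zero. The
    surviving cycles avoid the set [T] of all edges meeting the ball; [T] weighs at least [r], so
    [t] drops by one. *)
Lemma light_cycle_dim (n k : nat) (ends : 'I_n -> 'I_k * 'I_k) (w : 'I_n -> nat)
    (r Q t : nat) (E : {set 'I_n}) (U : {vspace 'rV['F_2]_n}) : (0 < r)%N ->
  (forall e, e \in E -> (w e < r)%N) ->
  (forall c, c \in U -> boundary ends c = 0 /\ supp c \subset E) ->
  (forall x, boundary ends x = 0 -> supp x \subset E -> x != 0 ->
    (8 * r <= wt w x)%N) ->
  (\sum_(e in E) w e <= Q * r)%N -> (\sum_(e in E) w e < t * r)%N ->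
  (\dim U <= t * Q)%N.
Proof.
move=> r0; elim: t E U => [|t IH] E U light cycU girth WQ Wt; first by rewrite mul0n in Wt.
have [->|nzU] := eqVneq U 0%VS; first by rewrite dimv0.
pose c := vpick U; have cU : c \in U := memv_pick U.
have cnz : c != 0 by rewrite vpick0.
have [bc sc] := cycU c cU; have scP := suppP _ _ sc.
have [e0 ce0] : exists e0, c 0 e0 != 0.
  apply/existsP; apply: contraNT cnz => /existsPn H; apply/eqP/rowP => e.
  by rewrite mxE; apply/eqP; rewrite -[_ == _]negbK H.
pose v := (ends e0).1.
pose X s := dist_ball ends w E (8 * r) v s; pose K s := cut ends E (X s).
have Xmono s s' u : (s <= s')%N -> X s u -> X s' u by move=> ss xs; apply: leq_trans ss.
(* Averaging over [r] radii, whose cuts have total size at most the weight of [E]. *)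
have [i /andP[ri i2r] Kr] : exists2 i, (r <= i < 2 * r)%N
    & (#|K i.+1| * r <= \sum_(e in E) w e)%N.
  pose f i := #|K i.+1|.
  have sumf : (\sum_(r <= i < 2 * r) f i <= \sum_(e in E) w e)%N.
    by apply: sum_cut => // i _; apply/fintype.subsetP => e; rewrite inE => /andP[].
  have [/hasP[i]|/hasPn H] :=
      boolP (has (fun i => f i * r <= \sum_(e in E) w e)%N (index_iota r (2 * r))).
    by rewrite mem_index_iota => ri fi; exists i.
  have : (r * (\sum_(e in E) w e).+1 <= r * \sum_(r <= i < 2 * r) f i)%N.
    rewrite {1}(_ : r = 2 * r - r)%N; last lia.
    rewrite -sum_nat_const_nat big_distrr /=.
    rewrite big_nat_cond [leqRHS]big_nat_cond; apply: leq_sum => i /andP[ri _].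
    by have := H i; rewrite mem_index_iota -ltnNge [(f i * r)%N]mulnC; apply.
  by rewrite leq_pmul2l // => /leq_trans/(_ sumf); rewrite ltnn.
pose s := i.+1; pose T := [set e in E | X s (ends e).1 || X s (ends e).2]%SET.
have TE : T \subset E by apply/fintype.subsetP => e; rewrite inE => /andP[].
have outside s' x : (s' <= s)%N -> boundary ends x = 0 -> supp x \subset E ->
    (forall e, e \in K s' -> x 0 e = 0) ->
    forall e, x 0 e != 0 -> ~~ X s' (ends e).1 /\ ~~ X s' (ends e).2.
  move=> ss bx sx Kx; apply: (cycle_uncut_outside girth light) => //.
  by rewrite /s in ss; lia.
(* Every ball of radius [j.+1] up to [s] has a nonempty cut: otherwise [c] would avoid the ball, but
   its edge [e0] has the centre [v] as an end. There are [s > r] such cuts, all inside [T]. *)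
have rT : (r <= \sum_(e in T) w e)%N.
  apply: (@leq_trans (\sum_(0 <= j < s) #|K j.+1|)%N); last first.
    apply: sum_cut => // j js; apply/fintype.subsetP => e; rewrite !inE => /andP[->] /=.
    apply: contraR => /norP[n1 n2]; rewrite -/(X _); apply/eqP.
    rewrite (contraNF (@Xmono j.+1 s _ js) n1).
    by rewrite (contraNF (@Xmono j.+1 s _ js) n2).
  apply: (@leq_trans (\sum_(0 <= j < s) 1)%N).
    by rewrite sum_nat_const_nat muln1 subn0 /s; lia.
  rewrite big_nat_cond [leqRHS]big_nat_cond; apply: leq_sum => j /andP[/andP[_ js] _].
  rewrite card_gt0; apply/eqP => K0.
  have := @outside j.+1 c js bc sc _ e0 ce0; rewrite K0.
  case=> [e|]; first by rewrite inE.
  by rewrite /X /dist_ball chain_dist0.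
pose E' := (E :\: T)%SET.
have WE : (\sum_(e in E) w e = \sum_(e in T) w e + \sum_(e in E') w e)%N.
  rewrite (big_setID T) /=; congr (_ + _)%N; apply: eq_bigl => e.
  by have /finset.setIidPr -> := TE.
apply: leq_trans (dim_le_vanishing (K s) U) _.
rewrite mulSn leq_add //.
  by rewrite -(leq_pmul2r r0); apply: leq_trans Kr WQ.
apply: (IH E') => [e|x|x bx /suppP sx||].
- by rewrite inE => /andP[_ /light].
- rewrite memv_cap => /andP[/cycU[bx sx] /mem_ker_coord_proj Kx]; split=> //.
  apply/suppP => e xe; have [n1 n2] := outside s x (leqnn s) bx sx Kx e xe.
  by rewrite !inE (negPf n1) (negPf n2) (suppP _ _ sx e xe).
- by apply: girth => //; apply/suppP => e /sx; rewrite inE => /andP[].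
- by move: WQ WE; lia.
- by move: Wt WE rT; rewrite mulSn; lia.
Qed.

(** Multiplying the weights by 8 allows [r = d] without a division. The edges of new weight at least
    [d] number at most [8 * q]; forcing them to zero leaves only light edges. The successor in
    [(8 * q).+1] makes the weight bound strict. *)
Lemma cycle_dim (n k : nat) (ends : 'I_n -> 'I_k * 'I_k) (w : 'I_n -> nat)
    (d q : nat) (E : {set 'I_n}) (U : {vspace 'rV['F_2]_n}) : (0 < d)%N ->
  (forall c, c \in U -> boundary ends c = 0 /\ supp c \subset E) ->
  (forall x, boundary ends x = 0 -> supp x \subset E -> x != 0 ->
    (d <= wt w x)%N) ->
  (\sum_(e in E) w e <= q * d)%N ->
  (\dim U <= 8 * q + (8 * q).+1 * (8 * q))%N.
Proof.
move=> d0 cycU girth Wq; pose w8 e := (8 * w e)%N.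
pose S := [set e in E | (d <= w8 e)%N]%SET.
have W8 : (\sum_(e in E) w8 e <= 8 * q * d)%N by rewrite -big_distrr -mulnA leq_mul2l.
apply: leq_trans (dim_le_vanishing S U) (leq_add _ _).
  rewrite -(leq_pmul2r d0); apply: leq_trans W8.
  rewrite -sum_nat_const big_mkcond [leqRHS]big_mkcond /=; apply: leq_sum => e _.
  by rewrite inE; case: (e \in E) => //=; case: ifP.
have WE : (\sum_(e in E :\: S) w8 e <= \sum_(e in E) w8 e)%N.
  by rewrite [leqRHS](big_setID S) /= leq_addl.
apply: (@light_cycle_dim n k ends w8 d (8 * q) (8 * q).+1 (E :\: S)%SET) => //.
- by move=> e; rewrite !inE => /andP[/nandP[/negPf->//|]]; rewrite -ltnNge.
- move=> c; rewrite memv_cap => /andP[/cycU[bc /suppP sc] /mem_ker_coord_proj Sc].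
  split=> //; apply/suppP => e ce; rewrite inE sc // andbT.
  by apply: contra ce => /Sc ->.
- move=> x bx /suppP sx xn; rewrite wt_scale leq_pmul2l //.
  by apply: girth => //; apply/suppP => e /sx; rewrite inE => /andP[].
- exact: leq_trans WE W8.
- by rewrite mulSn; lia.
Qed.

(** * Sums of codes *)

(** At each coordinate at most two of the three words are nonzero. *)
Lemma wt_two_words (n : nat) (w : 'I_n -> nat) (p z : 'rV['F_2]_n) :
  (wt w p + wt w (p + z) + wt w z <= 2 * \sum_(i < n) w i)%N.
Proof.
rewrite /wt -!big_split big_distrr /=; apply: leq_sum => i _.
rewrite -!mulnDl leq_mul2r mxE F2_addb; apply/orP; right.
by do 2 case: (_ != _).
Qed.

(** The words are the seven nontrivial combinations of [p], [q], [z]; at each coordinate either none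
    or exactly four of them are nonzero. *)
Lemma wt_six_words (n : nat) (w : 'I_n -> nat) (p q z : 'rV['F_2]_n) :
  (wt w p + wt w (p + z) + (wt w q + wt w (q + z)) +
   (wt w (p + q) + wt w (p + q + z)) + wt w z <= 4 * \sum_(i < n) w i)%N.
Proof.
rewrite /wt -!big_split big_distrr /=; apply: leq_sum => i _.
rewrite -!mulnDl leq_mul2r !mxE !F2_addb; apply/orP; right.
by do 3 case: (_ != 0).
Qed.

Lemma wt_split (m n : nat) (w : 'I_(m + n) -> nat) (x : 'rV['F_2]_(m + n)) :
  wt w x = (wt (w \o lshift n) (lsubmx x) + wt (w \o @rshift m n) (rsubmx x))%N.
Proof.
by rewrite /wt big_split_ord /=; congr (_ + _)%N; apply: eq_bigr => i _; rewrite !mxE.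
Qed.

Definition wcat (m n : nat) (v : 'I_m -> nat) (w : 'I_n -> nat) (i : 'I_(m + n)) : nat :=
  match fintype.split i with inl j => v j | inr j => w j end.

Lemma wcatl (m n : nat) (v : 'I_m -> nat) (w : 'I_n -> nat) (j : 'I_m) :
  wcat v w (lshift n j) = v j.
Proof. by rewrite /wcat -[lshift n j]/(unsplit (inl j)) unsplitK. Qed.

Lemma wcatr (m n : nat) (v : 'I_m -> nat) (w : 'I_n -> nat) (j : 'I_n) :
  wcat v w (rshift m j) = w j.
Proof. by rewrite /wcat -[rshift m j]/(unsplit (inr j)) unsplitK. Qed.

Lemma wt_wcat (m n : nat) (v : 'I_m -> nat) (w : 'I_n -> nat)
    (x : 'rV['F_2]_(m + n)) :
  wt (wcat v w) x = (wt v (lsubmx x) + wt w (rsubmx x))%N.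
Proof.
rewrite wt_split; congr (_ + _)%N; apply: eq_bigr => i _ /=.
  by rewrite wcatl.
by rewrite wcatr.
Qed.

Lemma sum_wcat (m n : nat) (v : 'I_m -> nat) (w : 'I_n -> nat) :
  (\sum_(i < m + n) wcat v w i = \sum_(i < m) v i + \sum_(i < n) w i)%N.
Proof.
rewrite big_split_ord /=; congr (_ + _)%N; apply: eq_bigr => i _.
  by rewrite wcatl.
by rewrite wcatr.
Qed.

Lemma minimal_word (n : nat) (C : bcode n) (P : pred 'rV['F_2]_n)
    (f : 'rV['F_2]_n -> nat) :
  (exists2 c, c \in C & P c) ->
  exists c, [/\ c \in C, P c & forall c', c' \in C -> P c' -> (f c <= f c')%N].
Proof.
move=> [c0 c0C Pc0].
have [//=|c /andP[cC Pc] min_c] := @arg_minnP _ c0 (fun c => (c \in C) && P c) f.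
  by rewrite c0C.
by exists c; split=> // c' c'C Pc'; apply: min_c; rewrite c'C.
Qed.

(* In C2, the code C1 (whose free coordinates have weights wl) can be traded for
   weights v on the glued coordinates: after doubling all weights (which keeps v
   integral), C2 still has large minimum weight, and a word of C1 that vanishes on
   the glued coordinates makes the total weight drop. *)
Definition weight_transfer (m k m' : nat) (C1 : bcode (m + k)) (C2 : bcode (k + m'))
    (wl : 'I_m -> nat) (v : 'I_k -> nat) : Prop :=
  (forall c2, c2 \in C2 -> exists c1,
     [/\ c1 \in C1, rsubmx c1 = lsubmx c2
       & (2 * wt wl (lsubmx c1) <= wt v (lsubmx c2))%N]) /\
  (forall z, z \in C1 -> rsubmx z = 0 ->
     (2 * \sum_(i < k) v i + wt wl (lsubmx z) <= 4 * \sum_(i < m) wl i)%N).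

Lemma mulmx_last_word (m k : nat) (c : 'rV['F_2]_(m + k)) (y : 'rV['F_2]_k) :
  c *m (last_word m y)^T = rsubmx c *m y^T.
Proof.
by rewrite -{1}[c]hsubmxK /last_word tr_row_mx mul_row_col trmx0 mulmx0 add0r.
Qed.

Lemma mulmx_first_word (m k : nat) (c : 'rV['F_2]_(k + m)) (y : 'rV['F_2]_k) :
  c *m (first_word m y)^T = lsubmx c *m y^T.
Proof.
by rewrite -{1}[c]hsubmxK /first_word tr_row_mx mul_row_col trmx0 mulmx0 addr0.
Qed.

Lemma notin_dual (n : nat) (C : bcode n) (y : 'rV['F_2]_n) :
  y \notin dual C -> exists2 c, c \in C & c *m y^T != 0.
Proof.
move=> ny; apply: contrapT => H; move/negP: ny; apply; apply/mem_dual => c cC.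
by apply/eqP; apply: contra_notT H => nz; exists c.
Qed.

Lemma row1_cases (y : 'rV['F_2]_1) : y = 0 \/ y = const_mx 1.
Proof.
case: (F2_cases (y 0 0)) => y0; [left|right]; apply/rowP => i;
  by rewrite ord1 y0 mxE.
Qed.

Lemma two_sum_transfer (m m' : nat) (C1 : bcode (m + 1)) (C2 : bcode (1 + m'))
    (wl : 'I_m -> nat) :
  two_sum_cond C1 C2 -> exists v, weight_transfer C1 C2 wl v.
Proof.
move=> [_ _ [_ /notin_dual[c0 c0C nz0]] _]; rewrite mulmx_last_word in nz0.
have r1 : rsubmx c0 = const_mx 1.
  case: (row1_cases (rsubmx c0)) => // r0; by rewrite r0 mul0mx eqxx in nz0.
have [|c [cC /eqP rc minc]] := @minimal_word _ C1 (fun c => rsubmx c == const_mx 1)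
    (fun c => wt wl (lsubmx c)).
  by exists c0 => //; apply/eqP.
(* [c] is a lightest word with glued coordinate 1; the factor 2 is the doubling in
   [weight_transfer]. For the second half, [c + z] competes with [c]. *)
exists (fun=> 2 * wt wl (lsubmx c))%N; split=> [c2 c2C|z zC rz].
  case: (row1_cases (lsubmx c2)) => l2.
    by exists 0; rewrite mem0v !linear0 l2 !wt0.
  by exists c; split; rewrite ?l2 // /wt big_ord_recl big_ord0 mxE /= mul1n addn0.
have := minc (c + z) (memvD cC zC); rewrite !linearD /= rc rz addr0 eqxx => /(_ isT).
rewrite big_ord_recl big_ord0 addn0.
have := wt_two_words wl (lsubmx c) (lsubmx z).
move: (wt wl (_ + _)) (wt wl (lsubmx c)) (wt wl (lsubmx z)) (\sum_(i < m) wl i)%N.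
lia.
Qed.

Definition i0 : 'I_3 := ord0.
Definition i1 : 'I_3 := lift ord0 ord0.
Definition i2 : 'I_3 := lift ord0 (lift ord0 ord0).

Lemma ord3_cases (i : 'I_3) : [\/ i = i0, i = i1 | i = i2].
Proof.
by case: i => [[|[|[|//]]] lti]; [apply: Or31 | apply: Or32 | apply: Or33];
  apply: val_inj.
Qed.

(** The word of weight 2 whose only zero is at [i]: indexing by the zero makes the three nonzero
    even words symmetric. *)
Definition even_word (i : 'I_3) : 'rV['F_2]_3 := const_mx 1 + delta_mx 0 i.

Lemma even_word_cases (y : 'rV['F_2]_3) : y *m (const_mx 1 : 'rV_3)^T = 0 ->
  y = 0 \/ exists i, y = even_word i.
Proof.
move=> /(congr1 (fun z : 'M['F_2]_1 => z 0 0)); rewrite !mxE !big_ord_recl big_ord0 !mxE.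
rewrite !mulr1 addr0 -/i0 -/i1 -/i2 => sum0.
have ext (z : 'rV['F_2]_3) : y 0 i0 = z 0 i0 -> y 0 i1 = z 0 i1 -> y 0 i2 = z 0 i2 -> y = z.
  by move=> E0 E1 E2; apply/rowP => i; case: (ord3_cases i) => ->.
move: sum0 ext; case: (F2_cases (y 0 i0)) => ->; case: (F2_cases (y 0 i1)) => ->;
  case: (F2_cases (y 0 i2)) => -> // sum0 ext.
- by left; apply: ext; rewrite mxE.
- by right; exists i0; apply: ext; rewrite !mxE //; apply: val_inj.
- by right; exists i1; apply: ext; rewrite !mxE //; apply: val_inj.
- by right; exists i2; apply: ext; rewrite !mxE //; apply: val_inj.
Qed.

Lemma even_word_add (i j l : 'I_3) : i != j -> i != l -> j != l ->
  even_word i + even_word j = even_word l.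
Proof.
case: (ord3_cases i) => ->; case: (ord3_cases j) => ->; case: (ord3_cases l) => -> // _ _ _;
by apply/rowP => a; case: (ord3_cases a) => ->; rewrite !mxE; apply: val_inj.
Qed.

Lemma hweight_even_word (i : 'I_3) : hweight (even_word i) = 2%N.
Proof.
rewrite /hweight /hdist -sum1dep_card big_mkcond !big_ord_recl big_ord0 -/i0 -/i1 -/i2.
by case: (ord3_cases i) => ->; rewrite !mxE.
Qed.

Lemma hweight_delta (i : 'I_3) : hweight (delta_mx 0 i) = 1%N.
Proof.
rewrite /hweight /hdist -sum1dep_card big_mkcond !big_ord_recl big_ord0 -/i0 -/i1 -/i2.
by case: (ord3_cases i) => ->; rewrite !mxE.
Qed.

(** By parity every glued part is 0 or an even word. As the unit word at [i] is not in the dual,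
    some word of [C] is nonzero at [i], so its glued part is [even_word j] with [j != i]. Applying
    this twice yields two different even words, and their sum is the third. *)
Lemma even_word_restrict (m : nat) (C : bcode (m + 3)) :
  three_sum_A1 C -> last_word m (const_mx 1) \in dual C ->
  forall i, exists2 c, c \in C & rsubmx c = even_word i.
Proof.
move=> A1 /mem_dual par.
have [J Jex] : exists J : 'I_3 -> 'I_3, forall i,
    J i != i /\ exists2 c, c \in C & rsubmx c = even_word (J i).
  have ex i : exists j, j != i /\ exists2 c, c \in C & rsubmx c = even_word j.
    have [_ /notin_dual[c cC]] := A1 _ (or_introl (hweight_delta i)).
    rewrite mulmx_last_word => nz; have := par c cC; rewrite mulmx_last_word.
    case/even_word_cases => [r0|[j rj]]; first by rewrite r0 mul0mx eqxx in nz.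
    exists j; split; last by exists c.
    apply: contraNneq nz => ji; rewrite rj ji; apply/eqP/matrixP => a b.
    rewrite !ord1 !mxE (bigD1 i) //= big1 ?addr0 => [|l /negPf li].
      by rewrite !mxE !eqxx; apply: val_inj.
    by rewrite !mxE li andbF mulr0.
  by have /boolp.choice[J HJ] := ex; exists J.
move=> i; have [ji [c cC rc]] := Jex i; set j := J i in ji rc *.
have [lj [c' c'C rc']] := Jex j; set l := J j in lj rc' *.
have [li|li] := eqVneq l i; first by exists c'; rewrite -?li.
exists (c + c'); first exact: memvD.
by rewrite linearD /= rc rc'; apply: even_word_add => //; rewrite eq_sym.
Qed.

Lemma bar3_sum_transfer (m m' : nat) (C1 : bcode (m + 3)) (C2 : bcode (3 + m'))
    (wl : 'I_m -> nat) :
  bar3_sum_cond C1 C2 -> exists v, weight_transfer C1 C2 wl v.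
Proof.
move=> [_ A1 _ [par1 /mem_dual par2]].
have /boolp.choice[p Hp] (i : 'I_3) : exists c,
    [/\ c \in C1, rsubmx c == even_word i
      & forall c', c' \in C1 -> rsubmx c' == even_word i ->
          (wt wl (lsubmx c) <= wt wl (lsubmx c'))%N].
  have [c cC rc] := even_word_restrict A1 par1 i.
  by apply: minimal_word => //; exists c => //; apply/eqP.
pose a i := wt wl (lsubmx (p i)).
have amin i c : c \in C1 -> rsubmx c = even_word i -> (a i <= wt wl (lsubmx c))%N.
  by move=> cC /eqP rc; have [_ _] := Hp i; apply.
have pC i : p i \in C1 by have [] := Hp i.
have rp i : rsubmx (p i) = even_word i by have [_ /eqP] := Hp i.
have tri i j l : i != j -> i != l -> j != l -> (a l <= a i + a j)%N.
  move=> ij il jl; apply: leq_trans (wt_add _ _ _); rewrite -linearD /=.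
  by apply: amin; rewrite ?memvD // linearD /= !rp; apply: even_word_add.
have t0 := tri i1 i2 i0 isT isT isT; have t1 := tri i0 i2 i1 isT isT isT.
have t2 := tri i0 i1 i2 isT isT isT.
(* The star weights: any two of them add up to twice the [a] of the third index, and all three to
   [a i0 + a i1 + a i2]. The triangle inequalities make the truncated subtraction exact. *)
exists (fun i => a i0 + a i1 + a i2 - 2 * a i)%N; split=> [c2 c2C|z zC rz].
  have := par2 c2 c2C; rewrite mulmx_first_word => /even_word_cases[l2|[i l2]].
    by exists 0; rewrite mem0v !linear0 l2 !wt0.
  exists (p i); split; rewrite ?rp // l2 /wt !big_ord_recl big_ord0 -/i0 -/i1 -/i2.
  by case: (ord3_cases i) => -> /=; rewrite !mxE /= -/(wt _ _) -/(a _); lia.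
(* Here [p i0 + p i1] stands in for [p i2], since it has the same glued part; translating by [z]
   keeps glued parts, so each minimum is counted twice. *)
have s6 := wt_six_words wl (lsubmx (p i0)) (lsubmx (p i1)) (lsubmx z).
have b0 : (a i0 <= wt wl (lsubmx (p i0) + lsubmx z))%N.
  by rewrite -linearD /=; apply: amin; rewrite ?memvD // linearD /= rp rz addr0.
have b1 : (a i1 <= wt wl (lsubmx (p i1) + lsubmx z))%N.
  by rewrite -linearD /=; apply: amin; rewrite ?memvD // linearD /= rp rz addr0.
have b2 : (a i2 <= wt wl (lsubmx (p i0) + lsubmx (p i1)))%N.
  rewrite -linearD /=; apply: amin; rewrite ?memvD // linearD /= !rp.
  exact: even_word_add.
have b2' : (a i2 <= wt wl (lsubmx (p i0) + lsubmx (p i1) + lsubmx z))%N.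
  rewrite -!linearD /=; apply: amin; rewrite ?memvD // !linearD /= !rp rz addr0.
  exact: even_word_add.
rewrite !big_ord_recl big_ord0 -/i0 -/i1 -/i2 -/(a i0) -/(a i1).
move: s6 b0 b1 b2 b2' t0 t1 t2; rewrite -/(a i0) -/(a i1).
move: (wt wl (lsubmx (p i0) + lsubmx (p i1) + lsubmx z)).
move: (wt wl (lsubmx (p i0) + lsubmx (p i1))) (wt wl (lsubmx (p i0) + lsubmx z)).
move: (wt wl (lsubmx (p i1) + lsubmx z)) (wt wl (lsubmx z)) (\sum_(i < m) wl i)%N.
move: (a i0) (a i1) (a i2); lia.
Qed.

(** In other terms, deleting the glued coordinates is injective on each summand. *)
Lemma two_sum_no_end_word (m m' : nat) (C1 : bcode (m + 1)) (C2 : bcode (1 + m')) :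
  two_sum_cond C1 C2 ->
  (forall y, last_word m y \in C1 -> y = 0) /\
  (forall y, first_word m' y \in C2 -> y = 0).
Proof.
move=> [_ _ [n1 _] [n2 _]]; split=> y yC; case: (row1_cases y) => // y1.
  by rewrite y1 (negPf n1) in yC.
by rewrite y1 (negPf n2) in yC.
Qed.

Lemma bar3_sum_no_end_word (m m' : nat) (C1 : bcode (m + 3)) (C2 : bcode (3 + m')) :
  bar3_sum_cond C1 C2 ->
  (forall y, last_word m y \in C1 -> y = 0) /\
  (forall y, first_word m' y \in C2 -> y = 0).
Proof.
move=> [_ A1 A2 [/mem_dual p1 /mem_dual p2]]; split=> y yC.
  have := p1 _ yC; rewrite mulmx_last_word row_mxKr => /even_word_cases[//|[i yi]].
  by have [] := A1 y; rewrite ?yC // yi hweight_even_word; right.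
have := p2 _ yC; rewrite mulmx_first_word row_mxKl => /even_word_cases[//|[i yi]].
by have [] := A2 y; rewrite ?yC // yi hweight_even_word; right.
Qed.

(* All words of C1 and C2 have even weight on the glued coordinates, so the words
   111 added to C1 and to C2 can only be used simultaneously. *)
Lemma bar3_sum_glue (m m' : nat) (C1 : bcode (m + 3)) (C2 : bcode (3 + m')) :
  bar3_sum_cond C1 C2 -> bar3_sum C1 C2 = code_glue C1 C2.
Proof.
move=> [_ _ _ [/mem_dual p1 /mem_dual p2]]; apply/vspaceP => x; apply/idP/idP; last first.
  case/mem_code_glue => c [c' [cC c'C E ->]]; apply/mem_code_glue; exists c, c'.
  by split=> //; apply/mem_add_word; left.
have odd111 : (const_mx 1 : 'rV['F_2]_3) *m (const_mx 1 : 'rV_3)^T != 0.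
  apply/eqP => /(congr1 (fun z : 'M['F_2]_1 => z 0 0)).
  by rewrite !mxE !big_ord_recl big_ord0 !mxE.
case/mem_code_glue => c [c' [/mem_add_word cC /mem_add_word c'C E ->]].
apply/mem_code_glue; case: cC c'C => [cC|[b bC cE]] [c'C|[b' b'C c'E]].
- by exists c, c'.
- move: odd111; have := p1 _ cC; rewrite mulmx_last_word E c'E linearD /= row_mxKl mulmxDl.
  by have := p2 _ b'C; rewrite mulmx_first_word => ->; rewrite addr0 => ->; rewrite eqxx.
- move: odd111; have := p2 _ c'C; rewrite mulmx_first_word -E cE linearD /= row_mxKr mulmxDl.
  by have := p1 _ bC; rewrite mulmx_last_word => ->; rewrite addr0 => ->; rewrite eqxx.
exists b, b'; split=> //.
  by move: E; rewrite cE c'E !linearD /= row_mxKr row_mxKl => /addrI.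
by rewrite cE c'E !linearD /= row_mxKr row_mxKl !add0r.
Qed.

Lemma dim_img_le (n m : nat) (f : 'Hom('rV['F_2]_n, 'rV['F_2]_m))
    (U : {vspace 'rV['F_2]_n}) : (\dim (f @: U) <= \dim U)%N.
Proof. by rewrite -(limg_ker_dim f U) leq_addl. Qed.

(** Project onto the right block. The image comes from [C2]. A word in the kernel uses a word of
    [C2] supported on the glued coordinates, hence 0, so its partner in [C1] vanishes there. *)
Lemma dim_code_glue (m k m' : nat) (C1 : bcode (m + k)) (C2 : bcode (k + m')) :
  (forall y, first_word m' y \in C2 -> y = 0) ->
  (\dim (code_glue C1 C2) <= \dim C2 + \dim (C1 :&: lker (linfun rsubmx)))%N.
Proof.
move=> end2; rewrite -(limg_ker_dim (linfun rsubmx) (code_glue C1 C2)) addnC.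
apply: leq_add.
  apply: leq_trans (dim_img_le (linfun rsubmx) C2); apply: dimvS; apply/subvP => y.
  case/memv_imgP => x /mem_code_glue[c [c' [_ c'C _ ->]]] ->; apply/memv_imgP.
  by exists c' => //; rewrite !lfunE /= row_mxKr.
rewrite -(@limg_dim_eq _ _ _ (linfun lsubmx)); last first.
  apply/eqP; rewrite -subv0; apply/subvP => x; rewrite !memv_cap !memv_ker !lfunE /=.
  case/andP => /andP[_ /eqP rx] /eqP lx.
  by rewrite -[x]hsubmxK rx lx row_mx0 mem0v.
apply: leq_trans (dim_img_le (linfun lsubmx) _); apply: dimvS; apply/subvP => y.
case/memv_imgP => x; rewrite memv_cap memv_ker lfunE /=.
case/andP => /mem_code_glue[c [c' [cC c'C E ->]]]; rewrite row_mxKr => /eqP r0 ->.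
apply/memv_imgP; exists c; last by rewrite !lfunE /= row_mxKl.
rewrite memv_cap cC memv_ker lfunE /= E (end2 (lsubmx c')) //.
by rewrite /first_word -r0 hsubmxK.
Qed.

(** * Dimension of 2-connected codes *)

(** The first summand covers the members of [D], whose dimension is at most their length; the second
    is the bound of [cycle_dim]. *)
Definition dim_bound (D : seq any_code) (q : nat) : nat :=
  (\max_(A <- D) tag A + (8 * q + (8 * q).+1 * (8 * q)))%N.

Lemma basic_code_dim (D : seq any_code) (q d n : nat) (C : bcode n)
    (w : 'I_n -> nat) (E : {set 'I_n}) (U : {vspace 'rV['F_2]_n}) :
  graphic (Code C) \/ Code C \in D -> (0 < d)%N ->
  (forall c, c \in U -> c \in C /\ supp c \subset E) ->
  (forall c, c \in C -> supp c \subset E -> c != 0 -> (d <= wt w c)%N) ->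
  (\sum_(e in E) w e <= q * d)%N ->
  (\dim U <= dim_bound D q)%N.
Proof.
move=> basic d0 UC girth Wq; case: basic => [[k [ends /= pc]]|inD].
  have bC c : c \in C <-> boundary ends c = 0.
    rewrite pc /boundary; split=> [H|H]; first by rewrite -[LHS]trmxK trmx_mul trmxK H trmx0.
    by rewrite -[LHS]trmxK trmx_mul trmxK H trmx0.
  apply: leq_trans (leq_addl _ _); apply: (cycle_dim d0 _ _ Wq) => [c /UC[/bC]|x /bC].
    by [].
  exact: girth.
apply: leq_trans (leq_addr _ _).
apply: leq_trans (leq_bigmax_seq _ inD isT) => /=.
by apply: leq_trans (dimvS (subvf U)) _; rewrite dimvf /dim /= mul1n.
Qed.

Lemma wt_col_perm (n : nat) (w : 'I_n -> nat) (s : 'S_n) (c : 'rV['F_2]_n) :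
  wt w (col_perm s c) = wt (fun j => w ((s^-1)%g j)) c.
Proof.
rewrite /wt [RHS](reindex_inj (@perm_inj _ s)); apply: eq_bigr => i _.
by rewrite mxE permK.
Qed.

Lemma perm_code1 (n : nat) (C : bcode n) : perm_code 1%g C = C.
Proof.
apply/vspaceP => x; apply/idP/idP => [/mem_perm_code[c cC xc]|xC].
  by rewrite (_ : x = c) //; apply/rowP => i; rewrite xc perm1.
by apply/mem_perm_code; exists x => // i; rewrite perm1.
Qed.

(** Complete [c2] by a word [c1] with the same glued part whose free part is paid for by [v]. The
    glued word is nonzero: otherwise [c1] would be supported on the glued coordinates, hence 0, and
    so would [c2]. *)
Lemma code_glue_step (m k m' : nat) (C1 : bcode (m + k)) (C2 : bcode (k + m'))
    (w : 'I_(m + m') -> nat) (v : 'I_k -> nat) (d : nat) :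
  (forall y, last_word m y \in C1 -> y = 0) ->
  weight_transfer C1 C2 (w \o lshift m') v ->
  (forall x, x \in code_glue C1 C2 -> x != 0 -> (d <= wt w x)%N) ->
  forall c2, c2 \in C2 -> c2 != 0 ->
    (2 * d <= wt (wcat v (fun j => 2 * w (rshift m j))) c2)%N.
Proof.
move=> end1 [trans _] girth c2 c2C c2n; have [c1 [c1C E le_v]] := trans c2 c2C.
pose x := row_mx (lsubmx c1) (rsubmx c2).
have xC : x \in code_glue C1 C2 by apply/mem_code_glue; exists c1, c2.
have xn : x != 0.
  apply: contra_neq c2n => x0.
  have l0 : lsubmx c1 = 0 by rewrite -[LHS](row_mxKl _ (rsubmx c2)) -/x x0 linear0.
  have r0 : rsubmx c2 = 0 by rewrite -[LHS](row_mxKr (lsubmx c1)) -/x x0 linear0.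
  rewrite -[c2]hsubmxK r0 -E (end1 (rsubmx c1)) ?row_mx0 //.
  by rewrite /last_word -l0 hsubmxK.
have := girth x xC xn; rewrite wt_wcat wt_scale wt_split row_mxKl row_mxKr.
by move=> le_d; apply: leq_trans (leq_add le_v (leqnn _)); rewrite -mulnDr leq_mul2l.
Qed.

Definition decomposes_over (D : seq any_code) (F : code_family) : Prop :=
  forall A, F A -> two_connected A ->
    (graphic A \/ A \in D) \/
    exists A1 A2 : any_code,
      [/\ is_two_sum A A1 A2 \/ is_bar3_sum A A1 A2,
          equiv_to_minor A A1, equiv_to_minor A A2,
          graphic A1 \/ A1 \in D
        & two_connected A2].

(** Induction on the length, passing from the sum to [C2] with [d] doubled. The potential [t]
    exceeds four times the total weight divided by [d]; it pays one [dim_bound] whenever [C1] has a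
    nonzero word vanishing on the glued coordinates. *)
Lemma two_connected_dim (F : code_family) (D : seq any_code) (q N : nat) :
  minor_closed F ->
  decomposes_over D F ->
  forall (A : any_code) (w : 'I_(tag A) -> nat) (d t : nat),
  (tag A < N)%N -> F A -> two_connected A -> (0 < d)%N ->
  (forall c, c \in tagged A -> c != 0 -> (d <= wt w c)%N) ->
  (\sum_(i < tag A) w i <= q * d)%N -> (4 * \sum_(i < tag A) w i < t * d)%N ->
  (\dim (tagged A) <= t * dim_bound D q)%N.
Proof.
move=> mcF dec; elim: N => // N IH A w d t AN FA tcA d0 girth Wq Wt.
have t0 : (0 < t)%N by case: t Wt.
have [basic|[A1 [A2 [sumA _ mA2 basic1 tcA2]]]] := dec A FA tcA.
  apply: leq_trans (leq_pmull _ t0).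
  case: A basic w girth Wq {AN FA tcA Wt} => n C basic w girth Wq.
  apply: (basic_code_dim (E := [set: 'I_n]%SET) basic d0) => [c cC||].
  - by split=> //; apply/finset.subsetT.
  - by move=> c cC _; apply: girth.
  - by under eq_bigl => i do rewrite inE.
have FA2 : F A2 := mcF _ _ FA mA2.
have [m [k [m' [C1 [C2 [s [E1 E2 km EA [end1 end2 trans]]]]]]]] :
    exists m k m' (C1 : bcode (m + k)) (C2 : bcode (k + m')) (s : 'S_(m + m')),
    [/\ A1 = Code C1, A2 = Code C2, (k < m)%N, A = Code (perm_code s (code_glue C1 C2))
      & [/\ forall y, last_word m y \in C1 -> y = 0,
            forall y, first_word m' y \in C2 -> y = 0
          & forall wl, exists v, weight_transfer C1 C2 wl v]].
  case: sumA => [[m [m' [C1 [C2 [s [E1 E2 cond EA]]]]]]|].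
    exists m, 1%N, m', C1, C2, s; split=> //.
      by have [m3 _ _ _] := cond; rewrite addn1 in m3.
    have [e1 e2] := two_sum_no_end_word cond.
    by split=> // wl; apply: two_sum_transfer.
  case=> [m [m' [C1 [C2 [s [E1 E2 cond EA]]]]]].
  exists m, 3%N, m', C1, C2, s; split=> //.
  - by have [[m7 _] _ _ _] := cond; rewrite addn3 in m7.
  - by rewrite EA bar3_sum_glue.
  have [e1 e2] := bar3_sum_no_end_word cond.
  by split=> // wl; apply: bar3_sum_transfer.
subst A A1 A2; move: w girth Wq Wt AN => /= w girth Wq Wt AN.
pose w' j := w ((s^-1)%g j).
have girth' x : x \in code_glue C1 C2 -> x != 0 -> (d <= wt w' x)%N.
  move=> xC xn; rewrite -wt_col_perm; apply: girth.
    by apply/mem_perm_code; exists x => // i; rewrite mxE.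
  apply: contra_neq xn => x0; apply/rowP => j.
  by have /rowP/(_ ((s^-1)%g j)) := x0; rewrite !mxE permKV.
have Ww' : (\sum_(i < m + m') w i = \sum_(i < m) w' (lshift m' i) +
                                \sum_(j < m') w' (rshift m j))%N.
  by rewrite (reindex_inj (@perm_inj _ (s^-1)%g)) big_split_ord.
have [v tr] := trans (w' \o lshift m').
pose w2 := wcat v (fun j => 2 * w' (rshift m j))%N.
have girth2 := code_glue_step end1 tr girth'.
have W2 : (\sum_(i < k + m') w2 i = \sum_(i < k) v i +
                                 2 * \sum_(j < m') w' (rshift m j))%N.
  by rewrite sum_wcat -big_distrr.
(* With [z = 0] this says that total weight over minimum weight does not grow; a nonzero [z] weighs
   at least [d], which lowers [t] by one. *)
have drop z : z \in C1 -> rsubmx z = 0 ->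
   (2 * \sum_(i < k + m') w2 i + wt (w' \o lshift m') (lsubmx z) <=
    4 * \sum_(i < m + m') w i)%N.
  move=> zC rz; have [_ /(_ z zC rz)] := tr; rewrite W2 Ww' /comp; lia.
have W2le : (\sum_(i < k + m') w2 i <= 2 * \sum_(i < m + m') w i)%N.
  by have := drop 0 (mem0v _) (linear0 _); lia.
have W2q : (\sum_(i < k + m') w2 i <= q * (2 * d))%N.
  by apply: leq_trans W2le _; rewrite mulnCA leq_mul2l.
have IH2 t2 : (4 * \sum_(i < k + m') w2 i < t2 * (2 * d))%N ->
    (\dim C2 <= t2 * dim_bound D q)%N.
  move=> Wt2; apply: (IH (Code C2) w2 (2 * d)%N t2) => //=.
  (* [k < m], from the length conditions of the sums, makes [C2] shorter than the sum. *)
  - by move: AN km; lia.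
  - by rewrite muln_gt0.
apply: leq_trans (dim_img_le _ _) _; apply: leq_trans (dim_code_glue _ end2) _.
set U := (C1 :&: lker _)%VS.
have [U0|Un] := eqVneq U 0%VS.
  rewrite U0 dimv0 addn0; apply: IH2.
  rewrite [(t * _)%N]mulnCA; move: W2le Wt.
  by move: (\sum_(i < k + m') w2 i)%N (\sum_(i < m + m') w i)%N (t * d)%N; lia.
have UP z : z \in U -> z \in C1 /\ rsubmx z = 0.
  by rewrite memv_cap memv_ker lfunE /= => /andP[? /eqP].
have girth1 z : z \in C1 -> rsubmx z = 0 -> z != 0 ->
    (d <= wt (w' \o lshift m') (lsubmx z))%N.
  move=> zC rz zn; have := girth' (row_mx (lsubmx z) 0).
  rewrite wt_split row_mxKl row_mxKr wt0 addn0; apply.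
    by apply/mem_code_glue; exists z, 0; rewrite mem0v !linear0 rz.
  apply: contra_neq zn => l0; rewrite -[z]hsubmxK rz.
  by rewrite -[lsubmx z](row_mxKl _ (0 : 'rV_m')) l0 linear0 row_mx0.
case: t t0 Wt => // t _ Wt; rewrite mulSn addnC leq_add //.
  (* Words supported in [E] vanish on the glued coordinates, which may therefore get weight 0. *)
  apply: (basic_code_dim (C := C1) (E := [set lshift k i | i : 'I_m]%SET) (d := d)
            (w := wcat (w' \o lshift m') (fun=> 0%N))) => //.
  - move=> z /UP[zC rz]; split=> //; apply/suppP => i.
    rewrite -[i]splitK; case: (fintype.split i) => j /=; first by move=> _; apply: imset_f.
    by move: rz => /rowP/(_ j); rewrite !mxE => ->; rewrite eqxx.
  - move=> z zC /suppP sz zn; rewrite wt_wcat.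
    apply: leq_trans (leq_addr _ _); apply: girth1 => //; apply/rowP => j; rewrite !mxE.
    apply/eqP; apply: contraT => /sz /imsetP[i _] /eqP.
    by rewrite eq_sym eq_lrshift.
  - apply: leq_trans Wq; rewrite Ww'; apply: leq_trans (leq_addr _ _).
    rewrite big_imset /=; last by move=> i j _ _; apply: lshift_inj.
    by apply: leq_sum => i _; rewrite wcatl.
apply: IH2; have [zC rz] := UP _ (memv_pick U).
have := drop _ zC rz; have := girth1 _ zC rz; rewrite vpick0 => /(_ Un).
rewrite [(t * (2 * d))%N]mulnCA; move: (wt _ _) Wt; rewrite [(t.+1 * d)%N]mulSn.
move: (\sum_(i < k + m') w2 i)%N (\sum_(i < m + m') w i)%N (t * d)%N; lia.
Qed.

(** * Splitting codes that are not 2-connected *)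

(** The words of [C] vanishing off [J] project injectively to [J], and by rank-nullity their
    dimension is that of the whole restriction. *)
Lemma extend_by_zero (n : nat) (J : {set 'I_n}) (C : bcode n) :
  (\dim (code_restrict J C) + \dim (code_restrict (~: J)%SET C))%N = \dim C ->
  forall x, x \in code_restrict J C -> exists c,
    [/\ c \in C, forall i, x 0 i = c 0 (enum_val i) & forall j, j \notin J -> c 0 j = 0].
Proof.
move=> dimJ; pose U := (C :&: lker (coord_proj (~: J)%SET))%VS.
have -> : code_restrict J C = (coord_proj J @: U)%VS.
  apply/esym/eqP; rewrite eqEdim limgS ?capvSl //=.
  rewrite (@limg_dim_eq _ _ _ (coord_proj J) U).
    have := limg_ker_dim (coord_proj (~: J)%SET) C; rewrite -/U.
    by move: dimJ; rewrite /code_restrict => <- /eqP; rewrite eqn_add2r => /eqP ->.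
  apply/eqP; rewrite -subv0; apply/subvP => x; rewrite !memv_cap.
  case/andP => /andP[_ /mem_ker_coord_proj x1] /mem_ker_coord_proj x2.
  rewrite memv0; apply/eqP/rowP => j; rewrite mxE.
  by have [/x2|jJ] := boolP (j \in J) => //; rewrite x1 // inE.
move=> x /memv_imgP[c]; rewrite memv_cap => /andP[cC /mem_ker_coord_proj c0] ->.
by exists c; split=> // [i|j jJ]; [rewrite coord_projE mxE | rewrite c0 // inE].
Qed.

Lemma code_restrict_minor (n : nat) (J : {set 'I_n}) (C : bcode n) :
  equiv_to_minor (Code C) (Code (code_restrict J C)).
Proof.
exists (Code (code_restrict J C)); last by exists 1%g; rewrite perm_code1.
have := has_minor_puncture (~: J)%SET (has_minor_refl (Code C)).
by rewrite /puncture finset.setCK.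
Qed.

Lemma restrict_min_wt (n : nat) (J : {set 'I_n}) (C : bcode n) (w : 'I_n -> nat)
    (d : nat) :
  (\dim (code_restrict J C) + \dim (code_restrict (~: J)%SET C))%N = \dim C ->
  (forall c, c \in C -> c != 0 -> (d <= wt w c)%N) ->
  forall x, x \in code_restrict J C -> x != 0 ->
    (d <= wt (fun i => w (enum_val i)) x)%N.
Proof.
move=> dimJ girth x xJ xn; have [c [cC xc c0]] := extend_by_zero dimJ xJ.
apply: leq_trans (girth c cC _) _.
  by apply: contra_neq xn => cz; apply/rowP => i; rewrite xc cz !mxE.
rewrite /wt (bigID (fun i => i \in J)) /= [X in (_ + X)%N]big1 ?addn0; last first.
  by move=> j /c0 ->; rewrite eqxx.
by rewrite big_enum_val; apply: leq_sum => i _; rewrite xc.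
Qed.

(** The bound is linear in the total weight, so that it adds up over the two sides of a separation;
    both sides keep [d] and [q]. *)
Lemma family_dim (F : code_family) (D : seq any_code) (q N : nat) :
  minor_closed F ->
  decomposes_over D F ->
  forall (n : nat) (C : bcode n) (w : 'I_n -> nat) (d : nat),
  (n < N)%N -> F (Code C) -> (0 < d)%N ->
  (forall c, c \in C -> c != 0 -> (d <= wt w c)%N) ->
  (\sum_(i < n) w i <= q * d)%N ->
  (\dim C * d <= 5 * dim_bound D q * \sum_(i < n) w i)%N.
Proof.
move=> mcF dec; elim: N => // N IH n C w d nN FC d0 girth Wq.
have [tc|] := pselect (two_connected (Code C)).
  have [->|Cn] := eqVneq C 0%VS; first by rewrite dimv0.
  have dW : (d <= \sum_(i < n) w i)%N.
    apply: leq_trans (girth _ (memv_pick C) _) _; first by rewrite vpick0.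
    by apply: leq_sum => i _; case: (_ != _); rewrite ?mul1n.
  (* The least admissible [t]. Rounding up costs one [d], which is at most the total weight; hence
     the constant 5. *)
  pose t := ((4 * \sum_(i < n) w i) %/ d).+1.
  have Wt : (4 * \sum_(i < n) w i < t * d)%N by apply: ltn_ceil.
  have := two_connected_dim (A := Code C) mcF dec (ltnSn n) FC tc d0 girth Wq Wt.
  have td : (t * d <= 5 * \sum_(i < n) w i)%N.
    have := leq_divM (4 * \sum_(i < n) w i) d; rewrite /t [(_.+1 * d)%N]mulSn.
    by move: (_ * d)%N => p; move: (\sum_(i < n) w i)%N dW; lia.
  move=> dimt; apply: (@leq_trans (t * dim_bound D q * d)%N).
    by rewrite leq_mul2r dimt orbT.
  by rewrite [leqLHS]mulnAC [leqRHS]mulnAC leq_mul2r td orbT.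
move=> /contrapT[/= J [Jn Jcn dimJ]].
have part (K : {set 'I_n}) : (~: K)%SET != finset.set0 ->
    (\dim (code_restrict K C) + \dim (code_restrict (~: K)%SET C))%N = \dim C ->
    (\dim (code_restrict K C) * d <= 5 * dim_bound D q * \sum_(i in K) w i)%N.
  move=> Kcn dimK; rewrite big_enum_val /=.
  apply: (IH #|K| (code_restrict K C)) => //.
  - apply: leq_trans (_ : #|K| < n)%N nN.
    rewrite -[X in (_ < X)%N]card_ord -(cardsC K) -[ltnLHS]addn0 ltn_add2l card_gt0.
    exact: Kcn.
  - exact: mcF FC (code_restrict_minor _ _).
  - exact: restrict_min_wt.
  - rewrite -big_enum_val; apply: leq_trans Wq; rewrite big_mkcond; apply: leq_sum => i _.
    by case: ifP.
have := part J Jcn dimJ; have := part (~: J)%SET; rewrite finset.setCK => /(_ Jn).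
rewrite addnC => /(_ dimJ) le2 le1.
rewrite -dimJ mulnDl (bigID (fun i => i \in J)) /= mulnDr leq_add //.
apply: leq_trans le2 _; rewrite leq_mul2l; apply/orP; right.
by rewrite leq_eqVlt; apply/orP; left; apply/eqP/eq_bigl => i; rewrite inE.
Qed.

(** * Asymptotics *)

Lemma min_dist_le_wt (n : nat) (C : bcode n) (c : 'rV['F_2]_n) :
  c \in C -> c != 0 -> (min_dist C <= wt (fun=> 1%N) c)%N.
Proof.
move=> cC cn; have := @bigminn_le _ (fun p : 'rV['F_2]_n * 'rV['F_2]_n =>
  [&& p.1 \in C, p.2 \in C & p.1 != p.2]) (fun p => hdist p.1 p.2) n (c, 0).
rewrite /= cC mem0v cn => /(_ isT) /leq_trans; apply.
rewrite /hdist -sum1dep_card big_mkcond; apply: leq_sum => i _.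
by rewrite mxE muln1; case: (_ != 0).
Qed.

(** The lower limit is the supremum of the tail infima, so one of these is positive; it is finite
    because it lies below a real number. *)
Lemma limn_einf_gt0 (R : realType) (u : nat -> R) :
  (0 < limn_einf (fun i => (u i)%:E))%E ->
  exists2 e : R, 0 < e & exists N, forall i, (N <= i)%N -> e <= u i.
Proof.
rewrite limn_einf_lim (cvg_lim _ (@cvg_einfs_sup _ _)) //.
move=> /ereal_sup_gt[_ [N _ <-]] infN.
have lb i : (N <= i)%N -> (einfs (fun i => (u i)%:E) N <= (u i)%:E)%E.
  by move=> Ni; apply: ereal_inf_lbound; exists i.
move: (einfs _ N) infN lb => [e|//|//] e0 lb; last by have := lb N (leqnn N).
by exists e; [rewrite -lte_fin | exists N => i /lb; rewrite lee_fin].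
Qed.

Theorem theorem6p9 (R : realType) (F : code_family) :
  almost_graphic F -> ~ asymptotically_good R F.
Proof.
move=> [mcF [D [_ dec]]].
move=> [c [Fc n_oo /limn_einf_gt0[e e0 [N1 ke]] /limn_einf_gt0[f f0 [N2 df]]]].
(* [q] exceeds [1 / f], so with unit weights the total [n] is at most [q] times the minimum
   distance, and [family_dim] bounds the dimension by [B]. *)
pose q := (Num.truncn f^-1).+1; pose B := (5 * dim_bound D q * q)%N.
have qf : 1 <= q%:R * f.
  by rewrite -ler_pdivrMr // div1r ltW // truncnS_gt.
(* From length [M] on, a rate of at least [e] forces dimension above [B]. *)
pose M := (Num.truncn (B%:R / e)).+1.
have [N3 _ nM] : \forall i \near \oo%classic, (M <= tag (c i))%N.
  by move/cvgnyPge: n_oo; apply.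
pose i := maxn N1 (maxn N2 N3).
have Mn : (M <= tag (c i))%N by apply: nM; rewrite /= /i !leq_max leqnn !orbT.
have {}ke : e <= (\dim (tagged (c i)))%:R / (tag (c i))%:R.
  by apply: ke; rewrite leq_maxl.
have {}df : f <= (min_dist (tagged (c i)))%:R / (tag (c i))%:R.
  by apply: df; rewrite /i !leq_max leqnn orbT.
move: (Fc i) ke df Mn; case: (c i) => n C /= FC ke df Mn.
have n0 : 0 < n%:R :> R by rewrite ltr0n; apply: leq_trans Mn.
rewrite ler_pdivlMr // in ke; rewrite ler_pdivlMr // in df.
have nqd : (n <= q * min_dist C)%N.
  rewrite -(ler_nat R) natrM; apply: le_trans (ler_wpM2l (ler0n _ _) df).
  by rewrite mulrA ler_peMl // ltW.
have d0 : (0 < min_dist C)%N.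
  by rewrite -(ltr0n R); apply: lt_le_trans df; apply: mulr_gt0.
have W1 : (\sum_(j < n) 1 = n)%N by rewrite sum1_card card_ord.
have := family_dim mcF dec (w := fun=> 1%N) (q := q) (ltnSn n) FC d0
  (@min_dist_le_wt n C).
rewrite W1 => /(_ nqd) kd.
have kB : (\dim C <= B)%N.
  rewrite -(leq_pmul2r d0); apply: leq_trans kd _.
  by rewrite /B -[leqRHS]mulnA leq_mul2l nqd orbT.
have := lt_le_trans (truncnS_gt (B%:R / e)); move=> /(_ n%:R).
rewrite ler_nat => /(_ Mn); rewrite ltr_pdivrMr // mulrC.
by move=> /lt_le_trans/(_ ke); rewrite ltr_nat ltnNge kB.
Qed.
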